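(* Suppose $\widetilde U$ and $\widehat U$ are ordered upper and lower solutions (nonincreasing case) of the scheme (NDS), and suppose that for every $m\ge1$, every $p\in\overline\Omega^h$, every $\alpha\neq\alpha'$ in $\{1,2\}$ and every $u\in\mathbb R^2$ with $\widehat U(p,t_m)\le u\le\widetilde U(p,t_m)$, $$\frac{\partial f_\alpha(p,t_m,u)}{\partial u_\alpha}\le c_\alpha(p,t_m),\qquad -\frac{\partial f_\alpha(p,t_m,u)}{\partial u_{\alpha'}}\le0,$$ where $c_\alpha$ are nonnegative bounded functions. Then there exists a solution $U$ of (NDS) with $\widehat U(p,t_m)\le U(p,t_m)\le\widetilde U(p,t_m)$ for all $p\in\overline\Omega^h$ and all $m\ge1$.
   Context: Data: $l_1,l_2,T>0$, $\omega=(0,l_1)\times(0,l_2)$, $Q_T=\omega\times(0,T]$, $\partial Q_T=\partial\omega\times(0,T]$; for $\alpha=1,2$: constants $\varepsilon_\alpha>0$, smooth functions $f_\alpha(x,y,t,u)$, $u=(u_1,u_2)$, $g_\alpha$ on $\partial Q_T$, $\psi_\alpha$ on $\overline\omega$, and smooth nonnegative $v_{\alpha,1},v_{\alpha,2}$ on $\overline Q_T$. Vector inequalities are componentwise. Convention: $f_\alpha(p,t_m,a_\alpha,b_{\alpha'})$ is the value of $f_\alpha$ when $u_\alpha=a_\alpha$ and $u_{\alpha'}=b_{\alpha'}$, where $\alpha'\neq\alpha$. Mesh: $x_i=ih_x$ ($0\le i\le N_x$, $h_x=l_1/N_x$), $y_j=jh_y$ ($0\le j\le N_y$, $h_y=l_2/N_y$),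 $t_m=m\tau$ ($0\le m\le N_\tau$, $\tau=T/N_\tau$). $\overline\Omega^h$ is the set of all $p=(x_i,y_j)$, $\Omega^h$ the interior ones, $\partial\Omega^h=\overline\Omega^h\setminus\Omega^h$. ''$m\ge1$'' means $1\le m\le N_\tau$. Operator: $\mathcal L^h_\alpha U_\alpha=-\varepsilon_\alpha(D_x^2U_\alpha+D_y^2U_\alpha)+v_{\alpha,1}D_x^1U_\alpha+v_{\alpha,2}D_y^1U_\alpha$, with $D_x^2,D_y^2$ the standard second central differences and $D_x^1,D_y^1$ the backward differences. Scheme (NDS): for $\alpha=1,2$, $m\ge1$, $(\mathcal L^h_\alpha(p,t_m)+\tau^{-1})U_\alpha(p,t_m)+f_\alpha(p,t_m,U)-\tau^{-1}U_\alpha(p,t_{m-1})=0$ for $p\in\Omega^h$; $U(p,t_m)=g(p,t_m)$ for $p\in\partial\Omega^h$; $U(p,0)=\psi(p)$ for $p\in\overline\Omega^h$. Ordered upper and lower solutions (nonincreasing case): $\widetilde U,\widehat U$ are such if, for all $m\ge1$ and $\alpha\ne\alpha'$: $\widetilde U\ge\widehat U$ on $\overline\Omega^h$; on $\Omega^h$, $(\mathcal L^h_\alpha+\tau^{-1})\widetilde U_\alpha(p,t_m)+f_\alpha(p,t_m,\widetilde U_\alpha,\widehat U_{\alpha'})-\tau^{-1}\widetilde U_\alpha(p,t_{m-1})\ge0$ and $(\mathcal L^h_\alpha+\tau^{-1})\widehat U_\alpha(p,t_m)+f_\alpha(p,t_m,\widehat U_\alpha,\widetilde U_{\alpha'})-\tau^{-1}\widehat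 U_\alpha(p,t_{m-1})\le0$; $\widehat U\le g\le\widetilde U$ on $\partial\Omega^h$; and $\widehat U(p,0)\le\psi(p)\le\widetilde U(p,0)$ on $\overline\Omega^h$. *)

(* Defs.v *)
From HB Require Import structures.
From mathcomp Require Import all_boot all_order all_algebra.
From mathcomp Require Import all_classical all_reals all_analysis.

Set Implicit Arguments.
Unset Strict Implicit.
Unset Printing Implicit Defensive.

Import Order.TTheory GRing.Theory Num.Theory.
Import numFieldNormedType.Exports.

Local Open Scope classical_set_scope.
Local Open Scope ring_scope.

(* C^k regularity on a set [B] meant to be open, through iterated directional
   derivatives; [V] is only used here with finite-dimensional spaces, where this
   is the usual notion.  At [k = 0] it is continuity at every point of [B]. *)
Fixpoint Ck_on (R : realType) (V : normedModType R) (k : nat) (B : set V)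
    (F : V -> R) : Prop :=
  match k with
  | 0%N => forall z, B z -> {for z, continuous F}
  | k'.+1 => (forall z, B z -> differentiable F z) /\
             (forall v : V, Ck_on k' B (fun z => 'D_v F z))
  end.

(* Smoothness (C^oo) on an arbitrary set [D]: locally, [F] is the restriction
   to [D] of a C^oo function on an open set.  Values of [F] outside [D] are
   irrelevant, and no behaviour is imposed near limit points of [D] that are
   not in [D] (such as t = 0 for the boundary data below). *)
Definition smooth_on (R : realType) (V : normedModType R) (D : set V)
    (F : V -> R) : Prop :=
  forall z, D z -> exists (B : set V) (G : V -> R),
    [/\ open_nbhs z B, forall k, Ck_on k B G &
        forall w, (D `&` B) w -> F w = G w].

(* The component indices alpha = 1, 2 are the two elements of ['I_2]; vectors of
   R^2 are row vectors. *)
Section Vectors.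
Variable R : realType.

Definition vle (a b : 'rV[R]_2) : Prop := forall al : 'I_2, a 0 al <= b 0 al.

(* The vector u with u_alpha = a_alpha and u_alpha' = b_alpha', alpha' != alpha. *)
Definition mix (al : 'I_2) (a b : 'rV[R]_2) : 'rV[R]_2 :=
  \row_be (if be == al then a 0 be else b 0 be).

End Vectors.

Definition omega_bar (R : realType) (l1 l2 : R) : set (R * R) :=
  `[0, l1] `*` `[0, l2].

Definition omega_bd (R : realType) (l1 l2 : R) : set (R * R) :=
  omega_bar l1 l2 `\` (`]0, l1[ `*` `]0, l2[).

(* Points of space-time are ((x, y), t). *)
Definition QT_bar (R : realType) (l1 l2 T : R) : set (R * R * R) :=
  omega_bar l1 l2 `*` `[0, T].

Definition QT_bd (R : realType) (l1 l2 T : R) : set (R * R * R) :=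
  omega_bd l1 l2 `*` `]0, T].

Record nds_data (R : realType) := NdsData {
  l1 : R;
  l2 : R;
  T : R;
  eps : 'I_2 -> R;
  f : 'I_2 -> R * R * R * 'rV[R]_2 -> R;
  g : 'I_2 -> R * R * R -> R;
  psi : 'I_2 -> R * R -> R;
  v1 : 'I_2 -> R * R * R -> R;
  v2 : 'I_2 -> R * R * R -> R;
  Nx : nat;
  Ny : nat;
  Nt : nat;
  l1_gt0 : 0 < l1;
  l2_gt0 : 0 < l2;
  T_gt0 : 0 < T;
  eps_gt0 : forall al, 0 < eps al;
  f_smooth : forall al, smooth_on (QT_bar l1 l2 T `*` setT) (f al);
  g_smooth : forall al, smooth_on (QT_bd l1 l2 T) (g al);
  psi_smooth : forall al, smooth_on (omega_bar l1 l2) (psi al);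
  v1_smooth : forall al, smooth_on (QT_bar l1 l2 T) (v1 al);
  v2_smooth : forall al, smooth_on (QT_bar l1 l2 T) (v2 al);
  v1_ge0 : forall al z, QT_bar l1 l2 T z -> 0 <= v1 al z;
  v2_ge0 : forall al z, QT_bar l1 l2 T z -> 0 <= v2 al z;
  Nx_gt0 : (0 < Nx)%N;
  Ny_gt0 : (0 < Ny)%N;
  Nt_gt0 : (0 < Nt)%N
}.

(* A vector mesh function: [U i j m] is the value at ((x_i, y_j), t_m); only
   the values at mesh indices (see [node], [level]) are ever constrained. *)
Definition meshfun (R : realType) := nat -> nat -> nat -> 'rV[R]_2.

Section Scheme.
Variables (R : realType) (P : nds_data R).

Definition hx : R := l1 P / (Nx P)%:R.
Definition hy : R := l2 P / (Ny P)%:R.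
Definition tau : R := T P / (Nt P)%:R.

Definition pt (i j : nat) : R * R := (i%:R * hx, j%:R * hy).
Definition ptt (i j m : nat) : R * R * R := (pt i j, m%:R * tau).

Definition node (i j : nat) : bool := (i <= Nx P)%N && (j <= Ny P)%N.
Definition interior_node (i j : nat) : bool :=
  (0 < i < Nx P)%N && (0 < j < Ny P)%N.
Definition boundary_node (i j : nat) : bool := node i j && ~~ interior_node i j.
Definition level (m : nat) : bool := (1 <= m <= Nt P)%N.

Definition Lh (al : 'I_2) (U : meshfun R) (i j m : nat) : R :=
  let w i j := U i j m 0 al in
  - eps P al * ((w i.+1 j - 2 * w i j + w i.-1 j) / hx ^+ 2 +
                (w i j.+1 - 2 * w i j + w i j.-1) / hy ^+ 2)
  + v1 P al (ptt i j m) * ((w i j - w i.-1 j) / hx)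
  + v2 P al (ptt i j m) * ((w i j - w i j.-1) / hy).

(* Left-hand side of the scheme, with the argument of f_alpha given separately. *)
Definition residual (al : 'I_2) (U : meshfun R) (u : 'rV[R]_2)
    (i j m : nat) : R :=
  (Lh al U i j m + tau^-1 * U i j m 0 al) + f P al (ptt i j m, u)
  - tau^-1 * U i j m.-1 0 al.

Definition nds_solution (U : meshfun R) : Prop :=
  [/\ forall al i j m, level m -> interior_node i j ->
        residual al U (U i j m) i j m = 0,
      forall al i j m, level m -> boundary_node i j ->
        U i j m 0 al = g P al (ptt i j m) &
      forall al i j, node i j -> U i j 0%N 0 al = psi P al (pt i j)].

Definition gvec (i j m : nat) : 'rV[R]_2 := \row_al g P al (ptt i j m).
Definition psivec (i j : nat) : 'rV[R]_2 := \row_al psi P al (pt i j).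

(* Nonincreasing case: each inequality for component alpha takes component
   alpha' of the argument of f_alpha from the other function of the pair. *)
Definition ordered_upper_lower (Ut Uh : meshfun R) : Prop :=
  [/\ forall i j m, level m -> node i j -> vle (Uh i j m) (Ut i j m),
      forall al i j m, level m -> interior_node i j ->
        0 <= residual al Ut (mix al (Ut i j m) (Uh i j m)) i j m /\
        residual al Uh (mix al (Uh i j m) (Ut i j m)) i j m <= 0,
      forall i j m, level m -> boundary_node i j ->
        vle (Uh i j m) (gvec i j m) /\ vle (gvec i j m) (Ut i j m) &
      forall i j, node i j ->
        vle (Uh i j 0%N) (psivec i j) /\ vle (psivec i j) (Ut i j 0%N)].

(* The partial derivative of f_alpha with respect to u_beta. *)
Definition df (al be : 'I_2) (i j m : nat) (u : 'rV[R]_2) : R :=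
  'D_(delta_mx 0 be) (fun w : 'rV[R]_2 => f P al (ptt i j m, w)) u.

End Scheme.

(* Main.v *)
Require Import Defs.
From mathcomp Require Import all_boot all_order all_algebra.
From mathcomp Require Import all_classical all_reals all_analysis.
From mathcomp Require Import ring lra.

Set Implicit Arguments.
Unset Strict Implicit.
Unset Printing Implicit Defensive.

Import Order.TTheory GRing.Theory Num.Theory.
Import numFieldNormedType.Exports.

Local Open Scope ring_scope.

(** The scheme is solved one time level at a time; only the existence at a
    single level needs an idea.

    Since [f_al] is nondecreasing in the other component, the system is
    monotone for the mixed order in which the first component increases while
    the second decreases.  In that order the mixed pairs
    [(Ut_1, Uh_2)] and [(Uh_1, Ut_2)] are an ordinary upper and an ordinary
    lower solution, and the coupled conditions defining ordered upper and lower
    solutions say exactly this.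

    At a fixed level the scheme is rewritten as a fixpoint equation
    [x = x - residual x / (d + c)], where [d > 0] is the coefficient of the
    unknown at the central node ([jacobi_diag]) and [c] is the bound on the
    derivative of [f_al] in its own component.  Adding [c] makes the right-hand
    side monotone for the mixed order between the two barriers: the
    off-diagonal coefficients of the discrete operator are nonpositive because
    the velocities are nonnegative and the differences are taken backward
    ([jacobi_numerator_monotone]), and [c * u_al - f_al u] is monotone by the
    mean value theorem along a segment of the box
    ([reaction_one_sided_bound]).  The barriers being sub- and superfixpoints,
    a fixpoint between them exists by the Knaster-Tarski argument
    ([tarski_fixpoint_mixed]): no inverse of the discrete operator, maximum
    principle or limit of iterates is involved.

    A solution squeezed between [Uh] and [Ut] at level [m - 1] preserves the
    barrier inequalities at level [m], because the previous level enters the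
    residual with the coefficient [- 1 / tau < 0]; so the construction
    ([level_solvable]) can be repeated up to the final level. *)

(** * Differentiating a smooth function in part of its variables *)

(** [F] need only agree with a differentiable function on [D * setT], which may
    have empty interior in the first factor; freezing a point of [D] there
    leaves a full neighborhood in the second factor, on which the agreement
    determines all derivatives. *)
Lemma smooth_on_slice_near (R : realType) (V W : normedModType R)
    (D : set V) (F : V * W -> R) (z : V) (w : W) :
  smooth_on (D `*` setT)%classic F -> D z ->
  exists2 H : W -> R, differentiable H w & {near w, (fun w' => F (z, w')) =1 H}.
Proof.
move=> sF Dz; have [B [G [[oB Bzw] Gs FG]]] := sF (z, w) (conj Dz I).
have slice_diff : differentiable (fun w' : W => (z, w')) w.
  by apply: differentiable_pair; [exact: differentiable_cst | exact: ex_diff].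
exists (fun w' => G (z, w')).
  apply: (@differentiable_comp _ _ _ _ (fun w' : W => (z, w')) G) => //.
  by have [dG _] := Gs 1%N; exact: dG.
have : nbhs w ((fun w' : W => (z, w')) @^-1` B)%classic.
  exact: (differentiable_continuous slice_diff) (open_nbhs_nbhs (conj oB Bzw)).
by apply: filterS => w' Bw'; apply: FG.
Qed.

Lemma smooth_on_slice_derivable (R : realType) (V W : normedModType R)
    (D : set V) (F : V * W -> R) (z : V) (w d : W) :
  smooth_on (D `*` setT)%classic F -> D z ->
  derivable (fun w' => F (z, w')) w d.
Proof.
move=> sF Dz; have [H dH FH] := smooth_on_slice_near w sF Dz.
apply: (@near_eq_derivable _ _ _ H); last exact: diff_derivable.
by apply: filterS FH => ? ->.
Qed.

(** [al] and [al'] exhaust the two coordinates, so this is linearity of the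
    differential applied to the decomposition of [d]. *)
Lemma smooth_on_slice_derive2 (R : realType) (V : normedModType R)
    (D : set V) (F : V * 'rV[R]_2 -> R) (z : V) (w d : 'rV[R]_2) (al al' : 'I_2) :
  smooth_on (D `*` setT)%classic F -> D z -> al' != al ->
  'D_d (fun w' => F (z, w')) w =
    d 0 al * 'D_(delta_mx 0 al) (fun w' => F (z, w')) w +
    d 0 al' * 'D_(delta_mx 0 al') (fun w' => F (z, w')) w.
Proof.
move=> sF Dz nal; have [H dH FH] := smooth_on_slice_near w sF Dz.
have dE v : 'D_v (fun w' => F (z, w')) w = 'd H w v.
  by rewrite (near_eq_derive _ FH) deriveE.
have {1}-> : d = d 0 al *: delta_mx 0 al + d 0 al' *: delta_mx 0 al'.
  rewrite {1}(row_sum_delta d) (bigD1 al) //= (bigD1 al') //= big1 ?addr0 //.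
  by move=> i; move: i al al' nal => [[|[|//]] ?] [[|[|//]] ?] [[|[|//]] ?].
by rewrite !dE linearD !linearZ.
Qed.

(** The difference quotients of [F] in the direction [v - u] and those of its
    restriction to the segment are literally the same functions, so directional
    derivability suffices. *)
Lemma segment_MVT (R : realType) (V : normedModType R) (F : V -> R) (u v : V) :
  (forall w, derivable F w (v - u)) ->
  exists2 s : R, s \in `[0, 1] & F v - F u = 'D_(v - u) F (u + s *: (v - u)).
Proof.
move=> dF; pose l (s : R) := F (u + s *: (v - u)).
have dl (s : R) : is_derive s (1 : R) l ('D_(v - u) F (u + s *: (v - u))).
  have quot : (fun h : R => h^-1 *: ((l \o shift s) (h *: 1) - l s)) =
      (fun h : R => h^-1 *: ((F \o shift (u + s *: (v - u))) (h *: (v - u)) -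
                     F (u + s *: (v - u)))).
    apply/funext => h; rewrite /l /= [h *: 1]mulr1 scalerDl addrCA //.
  by split; rewrite /derivable /derive quot //; exact: dF.
have [|s s01] := @MVT_segment R l (fun s => 'D_(v - u) F (u + s *: (v - u)))
  0 1 ler01 (fun s _ => dl s).
  by apply: derivable_within_continuous => s _; case: (dl s).
by rewrite subr0 mulr1 /l scale0r addr0 scale1r subrKC => ->; exists s.
Qed.

(** * Fixpoints of monotone maps on a mixed order interval *)

(** The pointwise supremum of the subfixpoints of the interval is a fixpoint.
    Inequalities are only required on [D], so that [Phi] may be arbitrary at
    irrelevant indices. *)
Lemma tarski_fixpoint (R : realType) (I : Type) (D : I -> Prop) (lo hi : I -> R)
    (Phi : (I -> R) -> I -> R) :
  let le (x y : I -> R) := forall i, D i -> x i <= y i in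
  le lo hi -> le lo (Phi lo) -> le (Phi hi) hi ->
  (forall x y, le lo x -> le x y -> le y hi -> le (Phi x) (Phi y)) ->
  exists x, [/\ le lo x, le x hi & forall i, D i -> Phi x i = x i].
Proof.
move=> le lohi loPhi Phihi mono.
have le_tr x y z : le x y -> le y z -> le x z.
  by move=> xy yz i Di; apply: le_trans (xy i Di) (yz i Di).
have le_rfl x : le x x by move=> i _.
pose S x := [/\ le lo x, le x hi & le x (Phi x)].
pose w i := sup [set x i | x in S]%classic.
have w_ub x : S x -> le x w.
  move=> Sx i Di; apply: ub_le_sup; last by exists x.
  by exists (hi i) => _ [y [_ yhi _] <-]; exact: yhi.
have w_least y : (forall x, S x -> le x y) -> le w y.
  move=> yub i Di; apply: ge_sup; first by exists (lo i), lo.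
  by move=> _ [x Sx <-]; exact: yub.
have low : le lo w by exact: w_ub.
have whi : le w hi by apply: w_least => x [].
have wPhi : le w (Phi w).
  apply: w_least => x Sx; have [lox _ xPhi] := Sx.
  by apply: le_tr xPhi _; apply: mono => //; exact: w_ub.
have Phiw : le (Phi w) w.
  have PhiwHi : le (Phi w) hi by apply: le_tr Phihi; exact: mono.
  apply: w_ub; split=> //; first exact: le_tr wPhi.
  by apply: mono.
by exists w; split=> // i Di; apply/le_anti; rewrite Phiw ?wPhi.
Qed.

(** The order of [R], reversed when [b] holds; letting [b] depend on an index
    gives componentwise orders that are increasing in some components and
    decreasing in the others. *)
Definition ole (R : realType) (b : bool) (x y : R) : bool :=
  if b then y <= x else x <= y.

(** Changing the sign of the components with reversed order conjugates the
    mixed order to the usual one. *)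
Lemma tarski_fixpoint_mixed (R : realType) (I : Type) (D : I -> Prop)
    (b : I -> bool) (lo hi : I -> R) (Phi : (I -> R) -> I -> R) :
  let le (x y : I -> R) := forall i, D i -> ole (b i) (x i) (y i) in
  le lo hi -> le lo (Phi lo) -> le (Phi hi) hi ->
  (forall x y, le lo x -> le x y -> le y hi -> le (Phi x) (Phi y)) ->
  exists x, [/\ le lo x, le x hi & forall i, D i -> Phi x i = x i].
Proof.
move=> le lohi loPhi Phihi mono.
pose s (x : I -> R) i := (-1) ^+ b i * x i.
have sK x : s (s x) = x by apply/funext => i; rewrite /s signrMK.
have sE x y : (forall i, D i -> s x i <= s y i) <-> le x y.
  by split=> xy i Di; have := xy i Di; rewrite /s /ole; case: (b i) => /=;
    rewrite ?expr0 ?expr1 ?mul1r ?mulN1r ?lerN2.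
have [||||w [low whi wfix]] := @tarski_fixpoint R I D (s lo) (s hi) (fun w => s (Phi (s w))).
- exact/sE.
- by rewrite sK; exact/sE.
- by rewrite sK; exact/sE.
- move=> x y; rewrite -[x]sK -[y]sK => /sE lox /sE xy /sE yhi.
  by apply/sE; rewrite !sK; apply: mono.
exists (s w); split; [by apply/sE; rewrite sK | by apply/sE; rewrite sK |].
by move=> i Di; apply: (canRL (signrMK (b i))); exact: wfix.
Qed.

(** * Monotonicity of the scheme at one time level *)

Lemma ord2_cases (al : 'I_2) : al = 0 \/ al = 1.
Proof. by case: al => [[|[|//]] lt]; [left | right]; apply/val_inj. Qed.

Lemma node_in_QT_bar (R : realType) (P : nds_data R) (i j m : nat) :
  node P i j -> level P m -> QT_bar (l1 P) (l2 P) (T P) (ptt P i j m).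
Proof.
have mesh_le (L : R) (k n : nat) : 0 < L -> (0 < n)%N -> (k <= n)%N ->
    `[0, L]%classic (k%:R * (L / n%:R)).
  move=> L0 n0 kn; rewrite /= in_itv /= mulr_ge0 ?divr_ge0 ?ler0n ?(ltW L0) //=.
  by rewrite mulrCA ger_pMr // ler_pdivrMr ?ltr0n // mul1r ler_nat.
move=> /andP[iN jN] /andP[_ mN]; split; first split.
- exact: mesh_le (l1_gt0 P) (Nx_gt0 P) iN.
- exact: mesh_le (l2_gt0 P) (Ny_gt0 P) jN.
- exact: mesh_le (T_gt0 P) (Nt_gt0 P) mN.
Qed.

Definition in_box (R : realType) (a b u : 'rV[R]_2) : Prop := vle a u /\ vle u b.

(** Moving from [u] to [v] increases [c * w_al - f_al w] along the segment: its
    directional derivative is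
    [(c - df al al) * (v - u)_al - df al al' * (v - u)_al'], a sum of two
    nonnegative terms. *)
Lemma reaction_one_sided_bound (R : realType) (P : nds_data R) (a b : 'rV[R]_2)
    (c : R) (al al' : 'I_2) (i j m : nat) (u v : 'rV[R]_2) :
  node P i j -> level P m -> al' != al ->
  (forall w, in_box a b w -> df P al al i j m w <= c /\ 0 <= df P al al' i j m w) ->
  in_box a b u -> in_box a b v ->
  u 0 al <= v 0 al -> v 0 al' <= u 0 al' ->
  c * u 0 al - f P al (ptt P i j m, u) <= c * v 0 al - f P al (ptt P i j m, v).
Proof.
move=> nij lm nal bnd [au ub] [av vb] uv vu.
have Q := node_in_QT_bar nij lm.
have [s] := segment_MVT (fun w =>
  @smooth_on_slice_derivable R _ _ _ _ _ w (v - u) (@f_smooth R P al) Q).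
rewrite in_itv /= => /andP[s0 s1].
rewrite (smooth_on_slice_derive2 _ _ (@f_smooth R P al) Q nal).
have /bnd : in_box a b (u + s *: (v - u)).
  split=> be; rewrite !mxE; move: (au be) (av be) (ub be) (vb be) => *; nra.
rewrite /df; set A := 'D__ _ _; set B := 'D__ _ _ => -[Ac B0].
rewrite !mxE => fE; nra.
Qed.

(** The coefficient of the central unknown [U i j m 0 al] in the linear part of
    [residual]. *)
Definition jacobi_diag (R : realType) (P : nds_data R) (al : 'I_2) (i j m : nat) : R :=
  2 * eps P al / hx P ^+ 2 + 2 * eps P al / hy P ^+ 2 +
  v1 P al (ptt P i j m) / hx P + v2 P al (ptt P i j m) / hy P + (tau P)^-1.

Lemma hx_gt0 (R : realType) (P : nds_data R) : 0 < hx P.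
Proof. by rewrite divr_gt0 ?l1_gt0 ?ltr0n ?Nx_gt0. Qed.

Lemma hy_gt0 (R : realType) (P : nds_data R) : 0 < hy P.
Proof. by rewrite divr_gt0 ?l2_gt0 ?ltr0n ?Ny_gt0. Qed.

Lemma tau_gt0 (R : realType) (P : nds_data R) : 0 < tau P.
Proof. by rewrite divr_gt0 ?T_gt0 ?ltr0n ?Nt_gt0. Qed.

Lemma interior_nodeW (R : realType) (P : nds_data R) (i j : nat) :
  interior_node P i j -> node P i j.
Proof. by move=> /andP[/andP[_ /ltnW ?] /andP[_ /ltnW ?]]; apply/andP. Qed.

Lemma jacobi_diag_gt0 (R : realType) (P : nds_data R) (al : 'I_2) (i j m : nat) :
  node P i j -> level P m -> 0 < jacobi_diag P al i j m.
Proof.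
move=> nij lm; have Q := node_in_QT_bar nij lm.
have x0 := ltW (hx_gt0 P); have y0 := ltW (hy_gt0 P).
have e0 : 0 <= 2 * eps P al by rewrite mulr_ge0 // ltW // eps_gt0.
have w1 := v1_ge0 al Q; have w2 := v2_ge0 al Q.
rewrite ltr_wpDl ?invr_gt0 ?tau_gt0 //; do ![apply: addr_ge0]; apply: divr_ge0;
  by rewrite ?exprn_ge0.
Qed.

(** The linear part of the scheme is an M-matrix: once the diagonal is moved to
    the left, all neighboring values carry nonnegative coefficients, and the
    central value occurs only in [c * U - f]. *)
Lemma jacobi_numerator_monotone (R : realType) (P : nds_data R) (al : 'I_2)
    (c : R) (U V : meshfun R) (u v : 'rV[R]_2) (i j m : nat) :
  interior_node P i j -> level P m ->
  (forall i' j', node P i' j' -> U i' j' m 0 al <= V i' j' m 0 al) ->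
  U i j m.-1 0 al <= V i j m.-1 0 al ->
  c * U i j m 0 al - f P al (ptt P i j m, u) <=
    c * V i j m 0 al - f P al (ptt P i j m, v) ->
  (jacobi_diag P al i j m + c) * U i j m 0 al - residual P al U u i j m <=
  (jacobi_diag P al i j m + c) * V i j m 0 al - residual P al V v i j m.
Proof.
move=> int lm UV UVprev react.
have Q := node_in_QT_bar (interior_nodeW int) lm.
pose ex := eps P al / hx P ^+ 2; pose ey := eps P al / hy P ^+ 2.
pose wx := v1 P al (ptt P i j m) / hx P; pose wy := v2 P al (ptt P i j m) / hy P.
have numE (X : meshfun R) r :
    (jacobi_diag P al i j m + c) * X i j m 0 al - residual P al X r i j m =
    ex * X i.+1 j m 0 al + (ex + wx) * X i.-1 j m 0 al +
    ey * X i j.+1 m 0 al + (ey + wy) * X i j.-1 m 0 al +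
    (tau P)^-1 * X i j m.-1 0 al + (c * X i j m 0 al - f P al (ptt P i j m, r)).
  rewrite /residual /Lh /jacobi_diag /ex /ey /wx /wy; ring.
have e0 : 0 <= eps P al by rewrite ltW ?eps_gt0.
have ex0 : 0 <= ex by rewrite divr_ge0 // exprn_ge0 // ltW // hx_gt0.
have ey0 : 0 <= ey by rewrite divr_ge0 // exprn_ge0 // ltW // hy_gt0.
have wx0 : 0 <= wx by rewrite divr_ge0 ?(v1_ge0 al Q) // ltW // hx_gt0.
have wy0 : 0 <= wy by rewrite divr_ge0 ?(v2_ge0 al Q) // ltW // hy_gt0.
have /andP[/andP[i0 iN] /andP[j0 jN]] := int.
rewrite !numE; apply: lerD; last exact: react.
do 4?apply: lerD; apply: ler_wpM2l; rewrite ?addr_ge0 //;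
  rewrite ?invr_ge0 ?(ltW (tau_gt0 P)) //; apply: UV; apply/andP; split=> //;
  by [exact: ltnW | exact: leq_trans (leq_pred _) (ltnW _)].
Qed.

(** The linear part of the residual decouples the components, so a barrier
    inequality for [Ut] or [Uh] transfers to a function that shares only the
    component [al] with it, up to the change of the previous level. *)
Lemma residual_previous_level (R : realType) (P : nds_data R) (al : 'I_2)
    (U V : meshfun R) (u : 'rV[R]_2) (i j m : nat) :
  (forall i' j', U i' j' m 0 al = V i' j' m 0 al) ->
  residual P al U u i j m =
  residual P al V u i j m + (tau P)^-1 * (V i j m.-1 0 al - U i j m.-1 0 al).
Proof. by move=> UV; rewrite /residual /Lh !UV; ring. Qed.

Lemma residual_ext (R : realType) (P : nds_data R) (al : 'I_2)
    (U V : meshfun R) (u : 'rV[R]_2) (i j m : nat) :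
  (forall i' j', U i' j' m = V i' j' m) -> U i j m.-1 = V i j m.-1 ->
  residual P al U u i j m = residual P al V u i j m.
Proof. by move=> UV UVp; rewrite /residual /Lh !UV UVp. Qed.
(** * Solving one time level and marching in time *)

Definition set_level (R : realType) (U : meshfun R) (m : nat)
    (x : 'I_2 * nat * nat -> R) : meshfun R :=
  fun i j k => if k == m then \row_be x (be, i, j) else U i j k.

(** A damped Jacobi iteration of the scheme at level [m]; [U] provides the
    values at level [m - 1].  Boundary values are overwritten by the data, so
    that the fixpoints on the mesh are the solutions at this level. *)
Definition jacobi_step (R : realType) (P : nds_data R)
    (c : 'I_2 -> nat -> nat -> nat -> R) (U : meshfun R) (m : nat)
    (x : 'I_2 * nat * nat -> R) (n : 'I_2 * nat * nat) : R :=
  let: (al, i, j) := n in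
  let W := set_level U m x in
  if interior_node P i j then
    x n - residual P al W (W i j m) i j m / (jacobi_diag P al i j m + c al i j m)
  else g P al (ptt P i j m).

(** In the mixed order the interval runs from [(Uh_1, Ut_2)] to
    [(Ut_1, Uh_2)]; these are the functions [lo] and [hi] of the proof, on which
    the arguments of [f_al] are precisely the ones in the definition of ordered
    upper and lower solutions. *)
Lemma level_solvable (R : realType) (P : nds_data R) (Ut Uh U : meshfun R)
    (c : 'I_2 -> nat -> nat -> nat -> R) (m : nat) :
  ordered_upper_lower P Ut Uh -> level P m ->
  (forall al i j, node P i j -> 0 <= c al i j m) ->
  (forall i j al al' w, node P i j -> al' != al ->
     in_box (Uh i j m) (Ut i j m) w ->
     df P al al i j m w <= c al i j m /\ 0 <= df P al al' i j m w) ->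
  (forall i j, node P i j -> in_box (Uh i j m.-1) (Ut i j m.-1) (U i j m.-1)) ->
  exists x, let W := set_level U m x in
    [/\ forall al i j, interior_node P i j -> residual P al W (W i j m) i j m = 0,
        forall al i j, boundary_node P i j -> W i j m 0 al = g P al (ptt P i j m) &
        forall i j, node P i j -> in_box (Uh i j m) (Ut i j m) (W i j m)].
Proof.
move=> [Hle Hres Hbd _] lm c0 Hf Uprev.
pose D (n : 'I_2 * nat * nat) := node P n.1.2 n.2 : Prop.
pose K al i j := jacobi_diag P al i j m + c al i j m.
have K_gt0 al i j : node P i j -> 0 < K al i j.
  by move=> nij; rewrite ltr_wpDr ?c0 ?jacobi_diag_gt0.
have m_neq : (m.-1 == m) = false by case: (m) lm => [|k _] //=; rewrite ltn_eqF.
have Wm x i j : set_level U m x i j m = \row_be x (be, i, j).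
  by rewrite /set_level eqxx.
have Wp x i j : set_level U m x i j m.-1 = U i j m.-1.
  by rewrite /set_level m_neq.
pose hi (n : 'I_2 * nat * nat) := mix 0 (Ut n.1.2 n.2 m) (Uh n.1.2 n.2 m) 0 n.1.1.
pose lo (n : 'I_2 * nat * nat) := mix 0 (Uh n.1.2 n.2 m) (Ut n.1.2 n.2 m) 0 n.1.1.
(* The order is reversed for the second component. *)
pose rev (n : 'I_2 * nat * nat) := n.1.1 != 0.
pose Phi := jacobi_step P c U m.
have step_le x al i j : node P i j ->
    (forall i' j', x (al, i', j') = Ut i' j' m 0 al) ->
    (\row_be x (be, i, j) = mix al (Ut i j m) (Uh i j m)) ->
    Phi x (al, i, j) <= x (al, i, j).
  move=> nij xU rowE; rewrite /Phi /jacobi_step; case: ifP => int; last first.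
    have [_ /(_ al)] := Hbd _ _ _ lm (introT andP (conj nij (negbT int))).
    by rewrite xU mxE.
  rewrite gerBl divr_ge0 ?(ltW (K_gt0 _ _ _ nij)) // Wm rowE.
  rewrite (@residual_previous_level _ _ _ _ Ut) => [|i' j']; last by rewrite Wm mxE.
  rewrite addr_ge0 ?(Hres _ _ _ _ lm int).1 // mulr_ge0 ?invr_ge0 ?(ltW (tau_gt0 P)) //.
  by rewrite Wp subr_ge0; exact: (Uprev _ _ nij).2.
have step_ge x al i j : node P i j ->
    (forall i' j', x (al, i', j') = Uh i' j' m 0 al) ->
    (\row_be x (be, i, j) = mix al (Uh i j m) (Ut i j m)) ->
    x (al, i, j) <= Phi x (al, i, j).
  move=> nij xU rowE; rewrite /Phi /jacobi_step; case: ifP => int; last first.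
    have [/(_ al) + _] := Hbd _ _ _ lm (introT andP (conj nij (negbT int))).
    by rewrite xU mxE.
  rewrite lerBrDr gerDl pmulr_lle0 ?invr_gt0 ?K_gt0 // Wm rowE.
  rewrite (@residual_previous_level _ _ _ _ Uh) => [|i' j']; last by rewrite Wm mxE.
  rewrite -[leRHS]addr0 lerD ?(Hres _ _ _ _ lm int).2 //.
  rewrite pmulr_rle0 ?invr_gt0 ?tau_gt0 // Wp subr_le0; exact: (Uprev _ _ nij).1.
have step_mono x y al al' i j : node P i j -> al' != al ->
    in_box (Uh i j m) (Ut i j m) (\row_be x (be, i, j)) ->
    in_box (Uh i j m) (Ut i j m) (\row_be y (be, i, j)) ->
    (forall i' j', node P i' j' -> x (al, i', j') <= y (al, i', j')) ->
    y (al', i, j) <= x (al', i, j) ->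
    Phi x (al, i, j) <= Phi y (al, i, j).
  move=> nij nal bx by_ xy yx; rewrite /Phi /jacobi_step; case: ifP => // int.
  have Kp := K_gt0 al _ _ nij.
  (* Over the denominator [K > 0] the step is the numerator whose monotonicity
     is known. *)
  have stepE z : z (al, i, j) - residual P al (set_level U m z)
        (set_level U m z i j m) i j m / K al i j =
      (K al i j * set_level U m z i j m 0 al -
       residual P al (set_level U m z) (set_level U m z i j m) i j m) / K al i j.
    by rewrite Wm mxE; field; rewrite gt_eqF.
  rewrite -/(K al i j) !stepE ler_pM2r ?invr_gt0 //.
  apply: jacobi_numerator_monotone => //; rewrite ?Wp //.
    by move=> i' j' nij'; rewrite !Wm !mxE; exact: xy.
  rewrite !Wm; apply: (reaction_one_sided_bound nij lm nal _ bx by_);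
    rewrite ?mxE ?xy //.
  by move=> w; exact: Hf nij nal.
(* In the second component the order is reversed and the two ends are
   exchanged, so the mixed interval is the box itself. *)
have between_box x i j : node P i j ->
    (forall n, D n -> ole (rev n) (lo n) (x n)) ->
    (forall n, D n -> ole (rev n) (x n) (hi n)) ->
    in_box (Uh i j m) (Ut i j m) (\row_be x (be, i, j)).
  move=> nij lox xhi; split=> be; rewrite mxE;
    move: (lox (be, i, j) nij) (xhi (be, i, j) nij);
    by case: (ord2_cases be) => ->; rewrite /ole /rev /lo /hi !mxE.
have [|||x y lox xy yhi|x [lox xhi xfix]] := @tarski_fixpoint_mixed R _ D rev lo hi Phi.
- move=> [[al i] j] nij; have := Hle _ _ _ lm nij al.
  by rewrite /ole /rev /lo /hi !mxE /=; case: (al == 0).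
- move=> [[al i] j] nij; rewrite /ole /rev /=.
  case: (ord2_cases al) => -> /=; [apply: step_ge | apply: step_le] => //;
    first [by move=> ? ?; rewrite /lo /mix !mxE |
           by apply/rowP => be; rewrite /lo /mix !mxE; case: (ord2_cases be) => ->].
- move=> [[al i] j] nij; rewrite /ole /rev /=.
  case: (ord2_cases al) => -> /=; [apply: step_le | apply: step_ge] => //;
    first [by move=> ? ?; rewrite /hi /mix !mxE |
           by apply/rowP => be; rewrite /hi /mix !mxE; case: (ord2_cases be) => ->].
- have ole_tr b (p q r : R) : ole b p q -> ole b q r -> ole b p r.
    by case: b => /= [qp rq|pq qr]; [exact: le_trans qp | exact: le_trans qr].
  move=> [[al i] j] nij.
  have bx : in_box (Uh i j m) (Ut i j m) (\row_be x (be, i, j)).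
    by apply: between_box => // n Dn; exact: ole_tr (xy n Dn) (yhi n Dn).
  have by_ : in_box (Uh i j m) (Ut i j m) (\row_be y (be, i, j)).
    by apply: between_box => // n Dn; exact: ole_tr (lox n Dn) (xy n Dn).
  (* For the second component the roles of [x] and [y] are exchanged. *)
  rewrite /ole /rev /=; case: (ord2_cases al) => -> /=.
    apply: (step_mono _ _ 0 1) => // [i' j' nij'|].
      exact: xy (0, i', j') nij'.
    exact: xy (1, i, j) nij.
  apply: (step_mono _ _ 1 0) => // [i' j' nij'|].
    exact: xy (1, i', j') nij'.
  exact: xy (0, i, j) nij.
exists x => W; split=> [al i j int|al i j /andP[nij nint]|i j nij].
- have nij := interior_nodeW int.
  have := xfix (al, i, j) nij; rewrite /Phi /jacobi_step int -/W -/(K al i j).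
  move=> /eqP; rewrite subr_eq addrC -subr_eq subrr eq_sym mulf_eq0 invr_eq0.
  by rewrite [K _ _ _ == 0]gt_eqF ?K_gt0 // orbF => /eqP.
- rewrite /W Wm mxE -(xfix (al, i, j) nij) /Phi /jacobi_step.
  by rewrite (negbTE nint).
- by rewrite /W Wm; exact: between_box.
Qed.

Theorem theorem11 (R : realType) (P : nds_data R) (Ut Uh : meshfun R)
    (c : 'I_2 -> nat -> nat -> nat -> R)
    (Hord : ordered_upper_lower P Ut Uh)
    (c_ge0 : forall (al : 'I_2) (i j m : nat),
       level P m -> node P i j -> 0 <= c al i j m)
    (c_bounded : forall al : 'I_2, exists M : R, forall i j m : nat,
       level P m -> node P i j -> c al i j m <= M)
    (Hf : forall (m i j : nat) (al al' : 'I_2) (u : 'rV[R]_2),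
       level P m -> node P i j -> al' != al ->
       vle (Uh i j m) u -> vle u (Ut i j m) ->
       df P al al i j m u <= c al i j m /\ - df P al al' i j m u <= 0) :
  exists U : meshfun R,
    nds_solution P U /\
    (forall i j m : nat, node P i j -> level P m ->
       vle (Uh i j m) (U i j m) /\ vle (U i j m) (Ut i j m)).
Proof.
(* The case [M = 0] provides the initial data, which lie in the box at level 0
   by hypothesis; the invariant on the box is needed to solve the next level. *)
have march M : (M <= Nt P)%N -> exists U : meshfun R,
    [/\ forall al i j m, (1 <= m <= M)%N -> interior_node P i j ->
          residual P al U (U i j m) i j m = 0,
        forall al i j m, (1 <= m <= M)%N -> boundary_node P i j ->
          U i j m 0 al = g P al (ptt P i j m),
        forall i j, node P i j -> U i j 0%N = psivec P i j &
        forall i j m, node P i j -> (m <= M)%N ->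
          in_box (Uh i j m) (Ut i j m) (U i j m)].
  elim: M => [_|M IH MN].
    exists (fun i j _ => psivec P i j).
    split=> [al i j [|m] //|al i j [|m] //|//|i j m nij].
    by rewrite leqn0 => /eqP->; have [_ _ _ Hini] := Hord; exact: Hini.
  have [U [Ures Ubd Uini Ubox]] := IH (ltnW MN).
  have lM : level P M.+1 by [].
  have [] := @level_solvable R P Ut Uh U c M.+1 Hord lM.
  - by move=> al i j; exact: c_ge0.
  - move=> i j al al' w nij nal [lw wt].
    by have [? ?] := Hf _ _ _ _ _ _ lM nij nal lw wt; rewrite -oppr_le0.
  - by move=> i j nij; exact: Ubox.
  move=> x; set W := set_level U M.+1 x => -[Wres Wbd Wbox].
  have WU i j k : (k <= M)%N -> W i j k = U i j k.
    by move=> kM; rewrite /W /set_level ltn_eqF.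
  exists W; split.
  - move=> al i j m /andP[m1]; rewrite leq_eqVlt => /predU1P[->|]; first exact: Wres.
    rewrite ltnS => mM int; rewrite WU // -(Ures al i j m) ?m1 //.
    apply: residual_ext => [i' j'|]; apply: WU => //.
    exact: leq_trans (leq_pred _) mM.
  - move=> al i j m /andP[m1]; rewrite leq_eqVlt => /predU1P[->|]; first exact: Wbd.
    by rewrite ltnS => mM bd; rewrite WU // Ubd ?m1.
  - by move=> i j nij; rewrite WU // Uini.
  - move=> i j m nij; rewrite leq_eqVlt => /predU1P[->|]; first exact: Wbox.
    by rewrite ltnS => mM; rewrite WU //; exact: Ubox.
have [U [Ures Ubd Uini Ubox]] := march _ (leqnn (Nt P)).
exists U; split; last by move=> i j m nij /andP[_ mN]; exact: Ubox.
split=> [al i j m lm|al i j m lm|al i j nij]; first exact: Ures.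
  exact: Ubd.
by rewrite Uini // mxE.
Qed.
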